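(* Let $U$ be an $r$-dimensional subspace of $\mathbb{R}^d$ and let $y=x+v$ with $x\in U$ and $0\ne v\in U^\perp$. Fix $\delta\in(0,1)$ and an integer $m\ge\max\{\frac83 r\mu(U)\log(2d/\delta),\,4\mu(v)\log(1/\delta)\}$, and let $\Omega$ be a list of $m$ indices sampled independently and uniformly with replacement from $[d]$. Define $$\alpha=\sqrt{\frac{2\mu(v)}{m}\log(1/\delta)}+\frac{2\mu(v)}{3m}\log(1/\delta),\quad \beta=(1+2\log(1/\delta))^2,\quad \gamma=\sqrt{\frac{8r\mu(U)}{3m}\log(2d/\delta)},$$ and assume $\gamma<1$. Then with probability at least $1-4\delta$, $$\frac{m(1-\alpha)-r\mu(U)\frac{\beta}{1-\gamma}}{d}\|v\|_2^2\ \le\ \|y_\Omega-\mathcal{P}_{U_\Omega}y_\Omega\|_2^2\ \le\ (1+\alpha)\frac{m}{d}\|v\|_2^2.$$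
   Context: For an $r$-dimensional subspace $U\subseteq\mathbb{R}^d$, $\mu(U)=\frac{d}{r}\max_{i\in[d]}\|\mathcal{P}_Ue_i\|_2^2$; for a nonzero vector $v\in\mathbb{R}^d$, $\mu(v)=d\|v\|_\infty^2/\|v\|_2^2$. For a list $\Omega\in[d]^m$ and $z\in\mathbb{R}^d$, $z_\Omega\in\mathbb{R}^m$ has $j$th entry $z(\Omega(j))$. Taking $U$ also to denote a $d\times r$ matrix with orthonormal columns spanning $U$, $U_\Omega$ is the $m\times r$ matrix whose $j$th row is row $\Omega(j)$ of $U$, and $\mathcal{P}_{U_\Omega}$ is the orthogonal projection in $\mathbb{R}^m$ onto the column span of $U_\Omega$. *)

(* Defs.v *)
From Stdlib Require Import Reals List Arith.
Import ListNotations.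
Open Scope R_scope.

(* Vectors in R^n are functions nat -> R (only indices < n matter);
   an n x k matrix is a function nat -> nat -> R (row, column). *)

Fixpoint sumR (n : nat) (f : nat -> R) : R :=
  match n with O => 0 | S k => sumR k f + f k end.

Fixpoint maxR (n : nat) (f : nat -> R) : R :=
  match n with O => 0 | S k => Rmax (maxR k f) (f k) end.

Definition norm2 (n : nat) (a : nat -> R) : R := sumR n (fun i => a i * a i).

Definition norminf (n : nat) (a : nat -> R) : R := maxR n (fun i => Rabs (a i)).

Definition orthonormal_cols (n k : nat) (A : nat -> nat -> R) : Prop :=
  forall a b, (a < k)%nat -> (b < k)%nat ->
    sumR n (fun i => A i a * A i b) = if Nat.eqb a b then 1 else 0.

Definition in_colspan (n k : nat) (A : nat -> nat -> R) (z : nat -> R) : Prop :=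
  exists c : nat -> R, forall i, (i < n)%nat -> z i = sumR k (fun a => A i a * c a).

Definition orth_colspan (n k : nat) (A : nat -> nat -> R) (z : nat -> R) : Prop :=
  forall a, (a < k)%nat -> sumR n (fun i => A i a * z i) = 0.

Definition is_orth_proj (n k : nat) (A : nat -> nat -> R) (z p : nat -> R) : Prop :=
  in_colspan n k A p /\ orth_colspan n k A (fun i => z i - p i).

(* Projection onto U = colspan(U) for U with orthonormal columns: P_U z = U U^T z *)
Definition proj_on (d r : nat) (U : nat -> nat -> R) (z : nat -> R) : nat -> R :=
  fun j => sumR r (fun a => U j a * sumR d (fun i => U i a * z i)).

Definition e_vec (i : nat) : nat -> R := fun j => if Nat.eqb i j then 1 else 0.

Definition mu_sub (d r : nat) (U : nat -> nat -> R) : R :=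
  INR d / INR r * maxR d (fun i => norm2 d (proj_on d r U (e_vec i))).

Definition mu_vec (d : nat) (v : nat -> R) : R :=
  INR d * (norminf d v) ^ 2 / norm2 d v.

Definition restr (Om : list nat) (z : nat -> R) : nat -> R :=
  fun j => z (nth j Om O).
Definition restr_mat (Om : list nat) (U : nat -> nat -> R) : nat -> nat -> R :=
  fun j a => U (nth j Om O) a.

Definition alpha_c (m : nat) (muv delta : R) : R :=
  sqrt (2 * muv / INR m * ln (1 / delta)) + 2 * muv / (3 * INR m) * ln (1 / delta).
Definition beta_c (delta : R) : R := (1 + 2 * ln (1 / delta)) ^ 2.
Definition gamma_c (d r m : nat) (muU delta : R) : R :=
  sqrt (8 * INR r * muU / (3 * INR m) * ln (2 * INR d / delta)).

Definition good_event (d r m : nat) (U : nat -> nat -> R) (y v : nat -> R)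
    (delta : R) (Om : list nat) : Prop :=
  let muU := mu_sub d r U in
  let a := alpha_c m (mu_vec d v) delta in
  let b := beta_c delta in
  let g := gamma_c d r m muU delta in
  forall p : nat -> R,
    is_orth_proj m r (restr_mat Om U) (restr Om y) p ->
    (INR m * (1 - a) - INR r * muU * (b / (1 - g))) / INR d * norm2 d v
      <= norm2 m (fun j => restr Om y j - p j)
    /\ norm2 m (fun j => restr Om y j - p j) <= (1 + a) * (INR m / INR d) * norm2 d v.

(* Main.v *)
(** Modulo the column span, [y] restricted to [Om] is [v] restricted to [Om],
    so the residual is [|v_Om|^2 - <w, U_Om^T v_Om>] with [U_Om w] the projection
    of [v_Om]; it is at most [|v_Om|^2] and at least
    [|v_Om|^2 - |U_Om^T v_Om|^2 / lambda_min(U_Om^T U_Om)].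
    Four events of probability at most [delta] are excluded, each with Markov's
    inequality for a potential that grows by a constant factor in expectation
    when an index is added to [Om]:
    - [|v_Om|^2] far above or far below its mean, with [exp(+- s |v_Om|^2)];
    - [U_Om^T v_Om] long, with the dimension-free [exp(sqrt(1 + |w|^2))];
      this works when [ln(1/delta) >= ln 4], and for larger [delta] there is
      nothing to prove;
    - [lambda_min(U_Om^T U_Om)] small, with [tr (1 - eta U_Om^T U_Om)^n], a finite
      substitute for the trace exponential of the matrix Chernoff bound. A rank one
      update of this trace is controlled to second order by telescoping and the
      log-convexity of [k |-> <u, M^k u>], so neither the Golden-Thompson inequality
      nor eigenvalues are needed. *)

Require Import Defs.
From Stdlib Require Import Reals List Arith Lia Lra ClassicalEpsilon FinFun.
From Coquelicot Require Import Coquelicot.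
Import ListNotations.
Open Scope R_scope.

(** * Finite sums and maxima *)

Lemma sumR_ext n f g : (forall i, (i < n)%nat -> f i = g i) -> sumR n f = sumR n g.
Proof.
  induction n as [|n IH]; intros H; simpl; [easy|].
  rewrite IH, H; auto.
Qed.

Lemma sumR_le n f g : (forall i, (i < n)%nat -> f i <= g i) -> sumR n f <= sumR n g.
Proof.
  induction n as [|n IH]; intros H; simpl; [lra|].
  apply Rplus_le_compat; auto.
Qed.

Lemma sumR_plus n f g : sumR n (fun i => f i + g i) = sumR n f + sumR n g.
Proof. induction n as [|n IH]; simpl; [|rewrite IH]; lra. Qed.

Lemma sumR_minus n f g : sumR n (fun i => f i - g i) = sumR n f - sumR n g.
Proof. induction n as [|n IH]; simpl; [|rewrite IH]; lra. Qed.

Lemma sumR_scal n c f : sumR n (fun i => c * f i) = c * sumR n f.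
Proof. induction n as [|n IH]; simpl; [|rewrite IH]; lra. Qed.

Lemma sumR_const n c : sumR n (fun _ => c) = INR n * c.
Proof.
  induction n as [|n IH]; [simpl; lra|].
  simpl sumR; rewrite IH, S_INR; lra.
Qed.

Lemma sumR_0 n f : (forall i, (i < n)%nat -> f i = 0) -> sumR n f = 0.
Proof. intros H. rewrite (sumR_ext n f (fun _ => 0) H), sumR_const; lra. Qed.

Lemma sumR_nonneg n f : (forall i, (i < n)%nat -> 0 <= f i) -> 0 <= sumR n f.
Proof. intros H. rewrite <- (sumR_0 n (fun _ => 0)) by easy. now apply sumR_le. Qed.

Lemma sumR_swap n k (f : nat -> nat -> R) :
  sumR n (fun i => sumR k (fun j => f i j)) = sumR k (fun j => sumR n (fun i => f i j)).
Proof.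
  induction n as [|n IH]; simpl.
  - now rewrite sumR_0.
  - now rewrite IH, sumR_plus.
Qed.

Lemma sumR_Sl n f : sumR (S n) f = f O + sumR n (fun i => f (S i)).
Proof.
  induction n as [|n IH]; [simpl; lra|].
  change (sumR (S (S n)) f) with (sumR (S n) f + f (S n)).
  rewrite IH; simpl; lra.
Qed.

Lemma sumR_term_le n f i :
  (i < n)%nat -> (forall j, (j < n)%nat -> 0 <= f j) -> f i <= sumR n f.
Proof.
  induction n as [|n IH]; intros Hi H; [lia|]; simpl.
  destruct (Nat.eq_dec i n) as [->|Hn].
  - assert (0 <= sumR n f) by (apply sumR_nonneg; auto). lra.
  - assert (f i <= sumR n f) by (apply IH; auto; lia).
    assert (0 <= f n) by auto. lra.
Qed.

Lemma sumR_e_vec n a f : (a < n)%nat -> sumR n (fun i => e_vec a i * f i) = f a.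
Proof.
  unfold e_vec.
  induction n as [|n IH]; intros Ha; [lia|]; simpl.
  destruct (Nat.eq_dec a n) as [->|Hn].
  - rewrite sumR_0, Nat.eqb_refl; [lra|].
    intros i Hi. destruct (Nat.eqb_spec n i); [lia|lra].
  - rewrite IH by lia. destruct (Nat.eqb_spec a n); [lia|lra].
Qed.

Lemma maxR_ge n f i : (i < n)%nat -> f i <= maxR n f.
Proof.
  induction n as [|n IH]; intros Hi; [lia|]; simpl.
  destruct (Nat.eq_dec i n) as [->|Hn]; [apply Rmax_r|].
  eapply Rle_trans; [apply IH; lia|apply Rmax_l].
Qed.

(** * Elementary bounds on the exponential *)

Lemma incr_from_0 (f f' : R -> R) x :
  0 <= x -> (forall y, 0 <= y -> is_derive f y (f' y)) ->
  (forall y, 0 <= y <= x -> 0 <= f' y) -> f 0 <= f x.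
Proof.
  intros Hx Hd Hp.
  destruct (MVT_gen f 0 x f') as [c [Hc E]].
  - intros y Hy. apply Hd. rewrite Rmin_left in Hy; lra.
  - intros y Hy. rewrite Rmin_left in Hy by lra.
    apply continuity_pt_filterlim, @ex_derive_continuous.
    exists (f' y). apply Hd; lra.
  - rewrite Rmin_left, Rmax_right in Hc by lra.
    specialize (Hp c Hc). nra.
Qed.

Lemma exp_le x y : x <= y -> exp x <= exp y.
Proof. intros [H | ->]; [left; now apply exp_increasing|lra]. Qed.

Lemma exp_ge_1 x : 1 + x <= exp x.
Proof. destruct (Req_dec x 0) as [->|H]; [rewrite exp_0; lra|]. left; now apply exp_ineq1. Qed.

Lemma exp_ge_2 x : 0 <= x -> 1 + x + x ^ 2 / 2 <= exp x.
Proof.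
  intros Hx.
  assert (H := incr_from_0 (fun y => exp y - (1 + y + y ^ 2 / 2)) (fun y => exp y - (1 + y)) x Hx).
  simpl in H. rewrite exp_0 in H.
  apply Rminus_le_0, Rle_trans with (1 - (1 + 0 + 0 * (0 * 1) / 2)); [lra|].
  apply H.
  - intros y Hy. auto_derive; [easy|lra].
  - intros y Hy. assert (G := exp_ge_1 y). lra.
Qed.

Lemma exp_neg_le x : 0 <= x -> exp (- x) <= 1 - x + x ^ 2 / 2.
Proof.
  intros Hx.
  assert (H := incr_from_0 (fun y => (1 - y + y ^ 2 / 2) - exp (- y))
                 (fun y => exp (- y) - (1 - y)) x Hx).
  simpl in H. rewrite Ropp_0, exp_0 in H.
  apply Rminus_le_0, Rle_trans with (1 - 0 + 0 * (0 * 1) / 2 - 1); [lra|].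
  apply H.
  - intros y Hy. auto_derive; [easy|lra].
  - intros y Hy. assert (G := exp_ge_1 (- y)). lra.
Qed.

(* The [2/1] Pade approximant of [exp]. *)
Lemma exp_le_pade x : 0 <= x -> exp x * (6 - 2 * x) <= 6 + 4 * x + x ^ 2.
Proof.
  intros Hx.
  (* Multiplying by [exp (- y)] makes the derivative a single expression, whose sign is given by
     [exp_ge_2]. *)
  assert (H := incr_from_0 (fun y => (6 + 4 * y + y ^ 2) * exp (- y) - (6 - 2 * y))
                 (fun y => 2 - 2 * ((1 + y + y ^ 2 / 2) * exp (- y))) x Hx).
  assert (0 <= (6 + 4 * x + x ^ 2) * exp (- x) - (6 - 2 * x)) as K.
  { apply Rle_trans with ((6 + 4 * 0 + 0 ^ 2) * exp (- 0) - (6 - 2 * 0)).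
    - rewrite Ropp_0, exp_0; lra.
    - apply H.
      + intros y Hy. auto_derive; [easy|simpl; lra].
      + intros y [Hy _]. rewrite exp_Ropp.
        assert (G := exp_ge_2 y Hy). assert (P := exp_pos y).
        assert ((1 + y + y ^ 2 / 2) * / exp y <= 1); [|lra].
        apply Rmult_le_reg_r with (exp y); [easy|]. field_simplify; lra. }
  rewrite exp_Ropp in K. assert (P := exp_pos x).
  apply Rmult_le_compat_r with (r := exp x) in K; [|lra].
  rewrite Rmult_0_l in K.
  replace (((6 + 4 * x + x ^ 2) * / exp x - (6 - 2 * x)) * exp x)
    with (6 + 4 * x + x ^ 2 - exp x * (6 - 2 * x)) in K by (field; lra).
  lra.
Qed.

(** The moment bound behind Bernstein's inequality. For [x >= 0], [(6 + 4 x + x^2) / (6 - 2 x)]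
    equals [1 + x + x^2 / (2 (1 - x / 3))], so the Pade bound applies and [x] may be raised to [c]
    in the denominator. For [x < 0] the Taylor bound with denominator 2 is already stronger. *)
Lemma exp_le_quad c x : 0 <= c < 3 -> x <= c -> exp x <= 1 + x + x ^ 2 / (2 * (1 - c / 3)).
Proof.
  intros Hc Hx.
  assert (0 < 2 * (1 - c / 3) <= 2) as D by lra.
  assert (0 <= x ^ 2) as Q by apply pow2_ge_0.
  assert (forall e, 0 < e <= 2 -> 2 * (1 - c / 3) <= e ->
    x ^ 2 / e <= x ^ 2 / (2 * (1 - c / 3))) as Mon.
  { intros e He Hle. apply Rmult_le_compat_l; [easy|]. apply Rinv_le_contravar; lra. }
  destruct (Rle_dec 0 x) as [H|H].
  - specialize (Mon (2 * (1 - x / 3))).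
    apply Rle_trans with (1 + x + x ^ 2 / (2 * (1 - x / 3))); [|apply Rplus_le_compat_l, Mon; lra].
    assert (G := exp_le_pade x H).
    apply Rmult_le_reg_r with (6 - 2 * x); [lra|].
    replace ((1 + x + x ^ 2 / (2 * (1 - x / 3))) * (6 - 2 * x)) with (6 + 4 * x + x ^ 2)
      by (field; lra). lra.
  - specialize (Mon 2). assert (G := exp_neg_le (- x)). rewrite Ropp_involutive in G.
    specialize (G ltac:(lra)). nra.
Qed.

(** As [ln 4 = 2 ln 2], it is enough that [exp 0.69 <= 2], which the Pade bound at 0.69 just
    gives. *)
Lemma ln_4_ge : 1.38 <= ln 4.
Proof.
  replace 4 with (2 * 2) by lra. rewrite ln_mult by lra.
  assert (exp 0.69 <= 2).
  { assert (H := exp_le_pade 0.69 ltac:(lra)). lra. }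
  assert (0.69 <= ln 2); [|lra].
  rewrite <- (ln_exp 0.69). apply ln_le; [apply exp_pos|easy].
Qed.

(** * The sample space of index lists, and events counted on it *)

Definition lsum (f : nat -> R) (l : list nat) : R := fold_right (fun i s => f i + s) 0 l.

Lemma sumR_nth f l : sumR (length l) (fun j => f (nth j l O)) = lsum f l.
Proof.
  induction l as [|i l IH]; [easy|].
  change (length (i :: l)) with (S (length l)).
  rewrite sumR_Sl. simpl. now rewrite IH.
Qed.

(** The sample space: a probability is a count divided by [d ^ m]. The newest draw stands at the
    head of the list. *)
Fixpoint words (d m : nat) : list (list nat) :=
  match m with
  | O => [[]]
  | S k => flat_map (fun l => map (fun i => i :: l) (seq 0 d)) (words d k)
  end.

Lemma in_words d m l : In l (words d m) -> length l = m /\ forall j, In j l -> (j < d)%nat.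
Proof.
  revert l. induction m as [|m IH]; simpl; intros l Hl.
  - destruct Hl as [<-|[]]. simpl; tauto.
  - apply in_flat_map in Hl as [l' [Hl' Hi]].
    apply in_map_iff in Hi as [i [<- Hi]]. apply in_seq in Hi.
    destruct (IH l' Hl') as [E F]. simpl. split; [now rewrite E|].
    intros j [<-|Hj]; [lia|auto].
Qed.

Lemma length_words d m : INR (length (words d m)) = INR d ^ m.
Proof.
  induction m as [|m IH]; [simpl; lra|].
  simpl words. rewrite (flat_map_constant_length (c := d)).
  - rewrite mult_INR, IH; simpl; lra.
  - intros l _. now rewrite length_map, length_seq.
Qed.

Lemma NoDup_words d m : NoDup (words d m).
Proof.
  induction m as [|m IH]; simpl; [repeat constructor; easy|].
  induction IH as [|l L Hl HL IHL]; simpl; [constructor|].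
  apply NoDup_app; [|easy|].
  - apply Injective_map_NoDup; [|apply seq_NoDup]. intros i j E; congruence.
  - intros w Hw Hw'. apply in_map_iff in Hw as [i [<- _]].
    apply in_flat_map in Hw' as [l' [Hl' Hi]].
    apply in_map_iff in Hi as [j [E _]]. congruence.
Qed.

(** Over [words d m], this is an expectation times [d ^ m]. *)
Definition total {A} (F : A -> R) (L : list A) : R := fold_right (fun l s => F l + s) 0 L.

Lemma total_app {A} (F : A -> R) L L' : total F (L ++ L') = total F L + total F L'.
Proof. induction L as [|l L IH]; simpl; [|rewrite IH]; lra. Qed.

Lemma total_words_S d m F :
  total F (words d (S m)) = total (fun l => sumR d (fun i => F (i :: l))) (words d m).
Proof.
  simpl. induction (words d m) as [|l L IH]; simpl; [easy|].
  rewrite total_app, IH. f_equal.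
  clear. induction d as [|d IH]; [easy|].
  rewrite seq_S, map_app, total_app, IH. simpl. lra.
Qed.

Lemma total_le {A} (F G : A -> R) L : (forall l, In l L -> F l <= G l) -> total F L <= total G L.
Proof.
  induction L as [|l L IH]; simpl; intros H; [lra|].
  apply Rplus_le_compat; auto.
Qed.

Lemma total_scal {A} c (F : A -> R) L : total (fun l => c * F l) L = c * total F L.
Proof. induction L as [|l L IH]; simpl; [|rewrite IH]; lra. Qed.

(** Classical, so that events quantifying over real vectors can be counted. *)
Definition decide (P : Prop) : bool := if excluded_middle_informative P then true else false.

Lemma decide_iff P : decide P = true <-> P.
Proof. unfold decide. destruct (excluded_middle_informative P); easy. Qed.

Definition count {A} (P : A -> Prop) (L : list A) : nat :=
  length (filter (fun l => decide (P l)) L).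

(** Markov's inequality without normalisation. *)
Lemma count_markov {A} (P : A -> Prop) (F : A -> R) tau L :
  (forall l, In l L -> 0 <= F l) -> (forall l, In l L -> P l -> tau <= F l) ->
  INR (count P L) * tau <= total F L.
Proof.
  unfold count. induction L as [|l L IH]; intros H0 H; simpl; [lra|].
  specialize (IH ltac:(simpl in *; auto) ltac:(simpl in *; auto)).
  assert (0 <= F l) by (apply H0; simpl; auto).
  destruct (decide (P l)) eqn:E; simpl length.
  - rewrite S_INR. apply -> decide_iff in E.
    assert (tau <= F l) by (apply H; simpl; auto). lra.
  - lra.
Qed.

Lemma count_or {A} (P Q : A -> Prop) L :
  (count (fun l => P l \/ Q l) L <= count P L + count Q L)%nat.
Proof.
  unfold count, decide. induction L as [|l L IH]; simpl; [lia|].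
  destruct (excluded_middle_informative (P l)), (excluded_middle_informative (Q l)),
    (excluded_middle_informative (P l \/ Q l)); simpl; try lia; tauto.
Qed.

Lemma count_not {A} (P : A -> Prop) L : (count P L + count (fun l => ~ P l) L = length L)%nat.
Proof.
  unfold count, decide. induction L as [|l L IH]; simpl; [lia|].
  destruct (excluded_middle_informative (P l)), (excluded_middle_informative (~ P l));
    simpl; try lia; tauto.
Qed.

(** One draw multiplies the total of [F] by at most [d * exp k]; after [m] draws Markov's inequality
    applies. The hypotheses speak only of lists of length at most [m] because the trace potential
    used later is controlled only on those. *)
Lemma count_supermartingale d m (P : list nat -> Prop) (F : list nat -> R) k tau :
  (forall l, (length l <= m)%nat -> (forall j, In j l -> (j < d)%nat) -> 0 <= F l) ->
  (forall l, (length l < m)%nat -> (forall j, In j l -> (j < d)%nat) ->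
     sumR d (fun i => F (i :: l)) <= INR d * exp k * F l) ->
  (forall l, length l = m -> (forall j, In j l -> (j < d)%nat) -> P l -> tau <= F l) ->
  INR (count P (words d m)) * tau <= INR d ^ m * exp (INR m * k) * F [].
Proof.
  intros H0 HS HP.
  apply Rle_trans with (total F (words d m)).
  - apply count_markov; intros l Hl; apply in_words in Hl as [E Hl]; auto.
    apply H0; [lia|easy].
  - clear HP. induction m as [|m IH].
    + simpl. rewrite Rmult_0_l, exp_0. lra.
    + rewrite total_words_S.
      apply Rle_trans with (INR d * exp k * total F (words d m)).
      * rewrite <- total_scal. apply total_le. intros l Hl.
        apply in_words in Hl as [E Hl]. apply HS; [lia|easy].
      * apply Rle_trans with (INR d * exp k * (INR d ^ m * exp (INR m * k) * F [])).
        -- apply Rmult_le_compat_l.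
           ++ apply Rmult_le_pos; [apply pos_INR|left; apply exp_pos].
           ++ apply IH; intros; [apply H0|apply HS]; auto; lia.
        -- rewrite S_INR, Rmult_plus_distr_r, exp_plus, Rmult_1_l. simpl. lra.
Qed.

(** * Scalar Bernstein inequalities for [|v_Om|^2] *)

Lemma sumR_sq_le d Y b :
  (forall i, (i < d)%nat -> 0 <= Y i <= b) -> sumR d (fun i => Y i ^ 2) <= b * sumR d Y.
Proof.
  intros HY. rewrite <- sumR_scal. apply sumR_le. intros i Hi. specialize (HY i Hi). nra.
Qed.

(** The new factor [exp (s * Y i)] is averaged with [exp_le_quad], and [1 + k <= exp k] closes the
    step. Negative [s] is allowed; for [Y >= 0] the cap [c = 0] then serves. *)
Lemma exp_lsum_step d Y s c k l :
  0 <= c < 3 -> (forall i, (i < d)%nat -> s * Y i <= c) ->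
  s * sumR d Y + s ^ 2 / (2 * (1 - c / 3)) * sumR d (fun i => Y i ^ 2) <= INR d * k ->
  sumR d (fun i => exp (s * lsum Y (i :: l))) <= INR d * exp k * exp (s * lsum Y l).
Proof.
  intros Hc Hs Hk. simpl.
  rewrite (sumR_ext d _ (fun i => exp (s * lsum Y l) * exp (s * Y i)))
    by (intros i _; rewrite <- exp_plus; f_equal; ring).
  rewrite sumR_scal, Rmult_comm. apply Rmult_le_compat_r; [left; apply exp_pos|].
  apply Rle_trans with (sumR d (fun i => 1 + s * Y i + s ^ 2 / (2 * (1 - c / 3)) * Y i ^ 2)).
  - apply sumR_le. intros i Hi.
    eapply Rle_trans; [apply (exp_le_quad c); auto|].
    right. field. lra.
  - rewrite !sumR_plus, sumR_const, !sumR_scal.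
    assert (H := exp_ge_1 k). assert (0 <= INR d) by apply pos_INR. nra.
Qed.

Section Bernstein.

Context (d m : nat) (Y : nat -> R) (mu L : R).
Hypothesis m_pos : (0 < m)%nat.
Hypothesis mu_pos : 0 < mu.
Hypothesis L_pos : 0 < L.
Hypothesis Y_bound : forall i, (i < d)%nat -> 0 <= Y i <= mu.
Hypothesis Y_mean : sumR d Y = INR d.

(** With [L = ln (1 / delta)] this is [m] times [alpha_c]. *)
Let t := sqrt (2 * INR m * mu * L) + 2 * mu * L / 3.

Let INR_m_pos : 0 < INR m.
Proof. now apply lt_0_INR. Qed.

Let t_pos : 0 < t.
Proof.
  unfold t. assert (H := sqrt_pos (2 * INR m * mu * L)).
  assert (0 < mu * L) by now apply Rmult_lt_0_compat. lra.
Qed.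

Let Y_sq : sumR d (fun i => Y i ^ 2) <= INR d * mu.
Proof. rewrite Rmult_comm, <- Y_mean. now apply sumR_sq_le. Qed.

(** The parameter [s = t / D] yields the exponent [t^2 / (2 D)], and [t] is chosen so that
    [t^2 >= 2 D L]. The second moment is at most [mu] because [Y^2 <= mu * Y] and [Y] has mean 1. *)
Lemma bernstein_upper :
  INR (count (fun l => INR m + t < lsum Y l) (words d m)) <= exp (- L) * INR d ^ m.
Proof.
  set (D := INR m * mu + t * mu / 3).
  assert (HD : 0 < D) by (unfold D; nra).
  set (s := t / D).
  assert (Hs : 0 < s) by now apply Rdiv_lt_0_compat.
  assert (Hc : 1 - s * mu / 3 = INR m * mu / D).
  { unfold s. replace (INR m * mu) with (D - t * mu / 3) by (unfold D; ring). field. lra. }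
  assert (0 < INR m * mu / D) by (apply Rdiv_lt_0_compat; nra).
  (* Over [m] draws this adds up to [s m + s t / 2], so that subtracting the threshold exponent
     [s (m + t)] leaves [- s t / 2]. *)
  set (k := s + s * t / (2 * INR m)).
  assert (C := count_supermartingale d m (fun l => INR m + t < lsum Y l)
    (fun l => exp (s * lsum Y l)) k (exp (s * (INR m + t)))).
  cbn [lsum fold_right] in C. rewrite Rmult_0_r, exp_0, Rmult_1_r in C.
  apply Rmult_le_reg_r with (exp (s * (INR m + t))); [apply exp_pos|].
  eapply Rle_trans; [apply C|].
  - intros; left; apply exp_pos.
  - intros l _ _. apply (exp_lsum_step d Y s (s * mu)).
    + split; nra.
    + intros i Hi. apply Rmult_le_compat_l; [lra|]. now apply Y_bound.
    + rewrite Hc, Y_mean. unfold k.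
      replace (s ^ 2 / (2 * (INR m * mu / D))) with (s * t / (2 * INR m) / mu)
        by (unfold s; field; repeat split; lra).
      assert (0 <= s * t / (2 * INR m) / mu).
      { repeat apply Rdiv_le_0_compat; try nra. }
      apply Rle_trans with (s * INR d + s * t / (2 * INR m) / mu * (INR d * mu)).
      * apply Rplus_le_compat_l, Rmult_le_compat_l; auto.
      * right; field; lra.
  - intros l _ _ Hl. apply exp_le, Rmult_le_compat_l; lra.
  - rewrite (Rmult_comm (exp (- L))), Rmult_assoc, <- exp_plus.
    apply Rmult_le_compat_l; [apply pow_le, pos_INR|]. apply exp_le.
    unfold k. replace (INR m * (s + s * t / (2 * INR m))) with (s * INR m + s * t / 2) by (field; lra).
    assert (L <= s * t / 2); [|lra].
    unfold s. replace (t / D * t / 2) with (t ^ 2 / (2 * D)) by (field; lra).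
    apply Rmult_le_reg_r with (2 * D); [lra|].
    unfold Rdiv; rewrite Rmult_assoc, Rinv_l, Rmult_1_r by lra.
    assert (Q : sqrt (2 * INR m * mu * L) * sqrt (2 * INR m * mu * L) = 2 * INR m * mu * L).
    { apply sqrt_sqrt. repeat apply Rmult_le_pos; lra. }
    assert (P := sqrt_pos (2 * INR m * mu * L)).
    unfold D, t. set (q := sqrt _) in *.
    assert (0 < mu * L) by now apply Rmult_lt_0_compat. nra.
Qed.

(** As [- s * Y <= 0], the cap is [c = 0] and the correction [t * mu / 3] disappears from the
    denominator; the square root part of [t] alone makes [t^2 >= 2 m mu L]. *)
Lemma bernstein_lower :
  INR (count (fun l => lsum Y l < INR m - t) (words d m)) <= exp (- L) * INR d ^ m.
Proof.
  set (s := t / (INR m * mu)).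
  assert (0 < INR m * mu) by nra.
  assert (Hs : 0 < s) by now apply Rdiv_lt_0_compat.
  set (k := - s + s * t / (2 * INR m)).
  assert (C := count_supermartingale d m (fun l => lsum Y l < INR m - t)
    (fun l => exp (- s * lsum Y l)) k (exp (- s * (INR m - t)))).
  cbn [lsum fold_right] in C. rewrite Rmult_0_r, exp_0, Rmult_1_r in C.
  apply Rmult_le_reg_r with (exp (- s * (INR m - t))); [apply exp_pos|].
  eapply Rle_trans; [apply C|].
  - intros; left; apply exp_pos.
  - intros l _ _. apply (exp_lsum_step d Y (- s) 0).
    + lra.
    + intros i Hi. specialize (Y_bound i Hi). nra.
    + rewrite Y_mean. unfold k.
      replace ((- s) ^ 2 / (2 * (1 - 0 / 3))) with (s * t / (2 * INR m) / mu)
        by (unfold s; field; repeat split; lra).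
      assert (0 <= s * t / (2 * INR m) / mu).
      { repeat apply Rdiv_le_0_compat; try nra. }
      apply Rle_trans with (- s * INR d + s * t / (2 * INR m) / mu * (INR d * mu)).
      * apply Rplus_le_compat_l, Rmult_le_compat_l; auto.
      * right; field; lra.
  - intros l _ _ Hl. apply exp_le. nra.
  - rewrite (Rmult_comm (exp (- L))), Rmult_assoc, <- exp_plus.
    apply Rmult_le_compat_l; [apply pow_le, pos_INR|]. apply exp_le.
    unfold k. replace (INR m * (- s + s * t / (2 * INR m))) with (- s * INR m + s * t / 2) by (field; lra).
    assert (L <= s * t / 2); [|lra].
    unfold s. replace (t / (INR m * mu) * t / 2) with (t ^ 2 / (2 * (INR m * mu))) by (field; lra).
    apply Rmult_le_reg_r with (2 * (INR m * mu)); [lra|].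
    unfold Rdiv; rewrite Rmult_assoc, Rinv_l, Rmult_1_r by lra.
    assert (Q : sqrt (2 * INR m * mu * L) * sqrt (2 * INR m * mu * L) = 2 * INR m * mu * L).
    { apply sqrt_sqrt. repeat apply Rmult_le_pos; lra. }
    assert (P := sqrt_pos (2 * INR m * mu * L)).
    unfold t. set (q := sqrt _) in *.
    assert (0 < mu * L) by now apply Rmult_lt_0_compat. nra.
Qed.

End Bernstein.

(** * Inner products and positive semidefinite forms *)

Definition dot (r : nat) (x y : nat -> R) : R := sumR r (fun a => x a * y a).

Lemma dot_comm r x y : dot r x y = dot r y x.
Proof. apply sumR_ext. intros; ring. Qed.

Lemma dot_plus_r r x y z : dot r x (fun a => y a + z a) = dot r x y + dot r x z.
Proof. unfold dot. rewrite <- sumR_plus. apply sumR_ext; intros; ring. Qed.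

Lemma dot_scal_r r c x y : dot r x (fun a => c * y a) = c * dot r x y.
Proof. unfold dot. rewrite <- sumR_scal. apply sumR_ext; intros; ring. Qed.

Lemma dot_plus_l r x y z : dot r (fun a => y a + z a) x = dot r y x + dot r z x.
Proof. now rewrite dot_comm, dot_plus_r, !(dot_comm r x). Qed.

Lemma dot_scal_l r c x y : dot r (fun a => c * y a) x = c * dot r y x.
Proof. now rewrite dot_comm, dot_scal_r, (dot_comm r x). Qed.

Lemma dot_self_nonneg r x : 0 <= dot r x x.
Proof. apply sumR_nonneg. intros; nra. Qed.

Lemma discriminant_nonpos a b c :
  0 <= a -> 0 <= c -> (forall t, 0 <= a + 2 * t * b + t ^ 2 * c) -> b ^ 2 <= a * c.
Proof.
  intros Ha Hc H.
  destruct (Req_dec c 0) as [->|Hn].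
  - destruct (Req_dec b 0) as [->|Hb]; [lra|].
    specialize (H (- (a + 1) / (2 * b))).
    replace (a + 2 * (- (a + 1) / (2 * b)) * b + (- (a + 1) / (2 * b)) ^ 2 * 0) with (-1) in H
      by (field; lra). lra.
  - specialize (H (- b / c)).
    apply Rmult_le_compat_r with (r := c) in H; [|lra].
    replace ((a + 2 * (- b / c) * b + (- b / c) ^ 2 * c) * c) with (a * c - b ^ 2) in H
      by (field; lra). lra.
Qed.

(** Symmetry brings linearity with it: moving [T] to the other side of the product distributes it
    over sums and multiples. *)
Definition symmetric (r : nat) (T : (nat -> R) -> nat -> R) : Prop :=
  forall x y, dot r (T x) y = dot r x (T y).

Definition psd (r : nat) (T : (nat -> R) -> nat -> R) : Prop :=
  forall x, 0 <= dot r x (T x).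

(** The form is nonnegative at [x + t y] for every [t], so its discriminant in [t] is
    nonpositive. *)
Lemma form_cauchy_schwarz r T x y :
  symmetric r T -> psd r T -> dot r x (T y) ^ 2 <= dot r x (T x) * dot r y (T y).
Proof.
  intros HS HP. apply discriminant_nonpos; auto. intros t.
  specialize (HP (fun a => x a + t * y a)).
  rewrite <- HS in HP.
  rewrite dot_plus_r, dot_scal_r, !HS, !dot_plus_l, !dot_scal_l in HP.
  rewrite <- (HS y x), (dot_comm r (T y) x) in HP. lra.
Qed.

Lemma cauchy_schwarz r x y : dot r x y ^ 2 <= dot r x x * dot r y y.
Proof. apply (form_cauchy_schwarz r (fun z => z)); [easy|exact (dot_self_nonneg r)]. Qed.

(** * A dimension-free Bernstein inequality for sums of vectors *)

Definition vsum (X : nat -> nat -> R) (l : list nat) : nat -> R :=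
  fun a => lsum (fun i => X i a) l.

Lemma vsum_cons_sq r X i l :
  dot r (vsum X (i :: l)) (vsum X (i :: l)) =
  dot r (vsum X l) (vsum X l) + 2 * dot r (vsum X l) (X i) + dot r (X i) (X i).
Proof.
  change (vsum X (i :: l)) with (fun a => X i a + vsum X l a).
  rewrite dot_plus_r, !dot_plus_l, (dot_comm r (X i) (vsum X l)). ring.
Qed.

(* [5.52 = 4 * 1.38], where [1.38 <= ln 4]. *)
Lemma exp_sqrt_step s p q :
  0 <= s -> 0 <= q <= / 5.52 -> p ^ 2 <= s * q ->
  exp (sqrt (1 + (s + 2 * p + q))) <=
  exp (sqrt (1 + s)) * (1 + p / sqrt (1 + s) + 1.4 * q).
Proof.
  intros Hs Hq Hp.
  assert (Hh : 1 <= sqrt (1 + s)) by (rewrite <- sqrt_1 at 1; apply sqrt_le_1_alt; lra).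
  assert (Hh2 := sqrt_sqrt (1 + s) ltac:(lra)).
  set (h := sqrt (1 + s)) in *.
  (* The increment of the square root along its tangent at [h^2 = 1 + s]; concavity bounds the true
     increment by it. *)
  set (y := (p + q / 2) / h).
  assert (Ey : y * h = p + q / 2) by (unfold y; field; lra).
  assert (Hn := sqrt_pos q). assert (Hn2 := sqrt_sqrt q ltac:(lra)). set (n := sqrt q) in *.
  assert (Hn3 : n <= 0.4257) by nra.
  assert (Hpn : Rabs p <= h * n).
  { apply Rsqr_incr_0_var; [|nra]. rewrite <- Rsqr_abs. unfold Rsqr. nra. }
  (* Here [|p + q / 2| <= h n (1 + n / 2)] with [n <= 0.4257], hence the factor 1.21285, whose
     square is below 1.48. *)
  assert (Hy2 : y ^ 2 <= 1.48 * q).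
  { assert (Rabs (p + q / 2) <= h * (n * 1.21285)).
    { eapply Rle_trans; [apply Rabs_triang|]. rewrite (Rabs_pos_eq (q / 2)) by lra. nra. }
    assert (Rabs y <= n * 1.21285).
    { unfold y. rewrite Rabs_div, (Rabs_pos_eq h) by lra.
      apply Rmult_le_reg_r with h; [lra|]. field_simplify; lra. }
    rewrite <- pow2_abs. assert (G := Rabs_pos y). nra. }
  assert (Hy : y <= 0.52) by nra.
  apply Rle_trans with (exp (h + y)).
  - apply exp_le. rewrite <- (sqrt_square (h + y)).
    + apply sqrt_le_1_alt. nra.
    (* Needed for [h + y >= 0]. From [p^2 <= s q <= ((s + q) / 2)^2] follows
       [p >= - (s + q) / 2]. *)
    + assert (0 <= h * h + (p + q / 2)).
      { assert (- ((s + q) / 2) <= p); [|lra].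
        apply Rnot_lt_le. intros Hlt. assert (0 <= (s - q) ^ 2) by apply pow2_ge_0.
        assert (0 < (- p - (s + q) / 2) * (- p + (s + q) / 2)) by (apply Rmult_lt_0_compat; lra).
        nra. }
      assert (0 <= (h + y) * h) by nra. nra.
  - rewrite exp_plus. apply Rmult_le_compat_l; [left; apply exp_pos|].
    (* The quadratic term costs at most [0.9 q], which with the [q / 2] inside [y] makes [1.4 q]. *)
    eapply Rle_trans; [apply (exp_le_quad 0.52); lra|].
    assert (y <= p / h + q / 2).
    { unfold y. unfold Rdiv at 1. rewrite Rmult_plus_distr_r. apply Rplus_le_compat_l.
      assert (/ h <= 1) by (rewrite <- Rinv_1; apply Rinv_le_contravar; lra). nra. }
    assert (y ^ 2 / (2 * (1 - 0.52 / 3)) <= 0.9 * q); [|lra].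
    apply Rmult_le_reg_r with (2 * (1 - 0.52 / 3)); [lra|].
    field_simplify; lra.
Qed.

(** In [exp_sqrt_step] the linear term averages to zero because the [X i] are centred, and the
    variance bound leaves a factor [exp (1.4 / m)] per draw. The potential starts at [exp 1], so its
    final mean is at most [exp 2.4]. *)
Lemma vector_bernstein d m r X L :
  (0 < m)%nat -> 1.38 <= L ->
  (forall a, (a < r)%nat -> sumR d (fun i => X i a) = 0) ->
  (forall i, (i < d)%nat -> dot r (X i) (X i) <= / (4 * L)) ->
  sumR d (fun i => dot r (X i) (X i)) * INR m <= INR d ->
  INR (count (fun l => (1 + 2 * L) ^ 2 < dot r (vsum X l) (vsum X l)) (words d m))
    <= exp (- L) * INR d ^ m.
Proof.
  intros Hm HL Hmean Hbound Hvar.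
  assert (Hm' : 0 < INR m) by now apply lt_0_INR.
  assert (C := count_supermartingale d m
    (fun l => (1 + 2 * L) ^ 2 < dot r (vsum X l) (vsum X l))
    (fun l => exp (sqrt (1 + dot r (vsum X l) (vsum X l)))) (1.4 / INR m) (exp (2.4 + L))).
  apply Rmult_le_reg_r with (exp (2.4 + L)); [apply exp_pos|].
  eapply Rle_trans; [apply C|].
  - intros; left; apply exp_pos.
  - intros l _ _. set (w := vsum X l). set (h := sqrt (1 + dot r w w)).
    apply Rle_trans with
      (sumR d (fun i => exp h * (1 + / h * dot r w (X i) + 1.4 * dot r (X i) (X i)))).
    + apply sumR_le. intros i Hi. rewrite vsum_cons_sq. fold w.
      rewrite (Rmult_comm (/ h)). apply exp_sqrt_step.
      * apply dot_self_nonneg.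
      * split; [apply dot_self_nonneg|]. eapply Rle_trans; [now apply Hbound|].
        apply Rinv_le_contravar; lra.
      * apply cauchy_schwarz.
    + rewrite sumR_scal, Rmult_comm. apply Rmult_le_compat_r; [left; apply exp_pos|].
      rewrite !sumR_plus, sumR_const, !sumR_scal.
      assert (E : sumR d (fun i => dot r w (X i)) = 0).
      { unfold dot. rewrite sumR_swap. apply sumR_0. intros a Ha.
        rewrite sumR_scal, Hmean; [ring|easy]. }
      rewrite E.
      assert (G := exp_ge_1 (1.4 / INR m)). assert (P := pos_INR d).
      assert (sumR d (fun i => dot r (X i) (X i)) <= INR d * / INR m).
      { apply Rmult_le_reg_r with (INR m); [easy|].
        rewrite Rmult_assoc, Rinv_l; lra. }
      apply Rle_trans with (INR d * (1 + 1.4 / INR m)); [unfold Rdiv; lra|].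
      now apply Rmult_le_compat_l.
  (* For [L >= 1.38], [1 + (1 + 2 L)^2 >= (2.4 + L)^2]. *)
  - intros l _ _ Hl. apply exp_le. rewrite <- (sqrt_square (2.4 + L)) by lra.
    apply sqrt_le_1_alt. nra.
  - replace (dot r (vsum X []) (vsum X [])) with 0
      by (symmetry; apply sumR_0; intros; unfold vsum; simpl; ring).
    rewrite Rplus_0_r, sqrt_1, Rmult_assoc, <- exp_plus, (Rmult_comm (exp (- L))), Rmult_assoc,
      <- exp_plus.
    right. do 2 f_equal. unfold Rdiv. rewrite (Rmult_comm 1.4), <- Rmult_assoc, Rinv_r; lra.
Qed.

(** * Powers, moments and traces of a symmetric positive operator *)

Definition power (T : (nat -> R) -> nat -> R) (k : nat) (x : nat -> R) : nat -> R := Nat.iter k T x.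

Definition moment (r : nat) (T : (nat -> R) -> nat -> R) (x : nat -> R) (k : nat) : R :=
  dot r x (power T k x).

Definition trace (r : nat) (T : (nat -> R) -> nat -> R) : R :=
  sumR r (fun a => T (e_vec a) a).

Lemma dot_e_vec r a y : (a < r)%nat -> dot r (e_vec a) y = y a.
Proof. apply sumR_e_vec. Qed.

Lemma power_add T i j x : power T (i + j) x = power T i (power T j x).
Proof. apply Nat.iter_add. Qed.

Section Powers.

Context (r : nat) (T : (nat -> R) -> nat -> R).
Hypothesis T_sym : symmetric r T.

Lemma power_symmetric k : symmetric r (power T k).
Proof.
  induction k as [|k IH]; intros x y; [easy|].
  change (power T (S k) x) with (T (power T k x)).
  rewrite T_sym, IH, <- Nat.add_1_r, power_add. easy.
Qed.

Lemma dot_power_power i j x y : dot r (power T i x) (power T j y) = dot r x (power T (i + j) y).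
Proof. now rewrite power_symmetric, power_add. Qed.

Hypothesis T_pos : psd r T.

(** An even power gives a squared norm [|T^j x|^2], an odd one the form of [T] at [T^j x]. *)
Lemma power_positive k : psd r (power T k).
Proof.
  intros x. destruct (Nat.Even_or_Odd k) as [[j ->]|[j ->]].
  - replace (2 * j)%nat with (j + j)%nat by lia. rewrite <- dot_power_power.
    apply dot_self_nonneg.
  - replace (2 * j + 1)%nat with (j + S j)%nat by lia. rewrite <- dot_power_power.
    apply T_pos.
Qed.

Lemma moment_nonneg x k : 0 <= moment r T x k.
Proof. apply power_positive. Qed.

(** Cauchy-Schwarz for the form of [T^k] at [x] and [T x]. *)
Lemma moment_log_convex x k : moment r T x (S k) ^ 2 <= moment r T x k * moment r T x (S (S k)).
Proof.
  assert (H := form_cauchy_schwarz r (power T k) x (T x) (power_symmetric k) (power_positive k)).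
  change (T x) with (power T 1 x) in H.
  rewrite dot_power_power, <- !power_add in H.
  unfold moment. replace (S k) with (k + 1)%nat by lia.
  now replace (S (k + 1)) with (1 + (k + 1))%nat by lia.
Qed.

(** By log-convexity the ratios of consecutive moments increase. A vanishing moment, for which the
    ratio is undefined, is treated apart. *)
Lemma moment_shift x a b : (a <= b)%nat ->
  moment r T x (S a) * moment r T x b <= moment r T x a * moment r T x (S b).
Proof.
  set (q := moment r T x).
  assert (Hq : forall k, 0 <= q k) by apply moment_nonneg.
  induction 1 as [|b Hb IH]; [right; ring|].
  assert (H := moment_log_convex x b). fold q in H.
  destruct (Req_dec (q (S b)) 0) as [E|E].
  - rewrite E, Rmult_0_r. now apply Rmult_le_pos.
  - assert (H0 := Hq (S b)).
    assert (0 < q b). { destruct (Hq b) as [G|G]; [easy|]. rewrite <- G in H. nra. }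
    apply Rmult_le_reg_r with (q b); [easy|].
    apply Rle_trans with (q (S a) * q b * q (S b)); [right; ring|].
    apply Rle_trans with (q a * q (S b) * q (S b)); [apply Rmult_le_compat_r; lra|].
    assert (K := Hq a). nra.
Qed.

(** Shifting weight from the smaller exponent to the larger, one unit at a time, only increases the
    product. *)
Lemma moment_mul_le x p j :
  moment r T x p * moment r T x j <= moment r T x 0 * moment r T x (p + j).
Proof.
  enough (H : forall p j, (p <= j)%nat ->
    moment r T x p * moment r T x j <= moment r T x 0 * moment r T x (p + j)).
  { destruct (Nat.le_ge_cases p j); [auto|].
    rewrite Rmult_comm, Nat.add_comm. auto. }
  clear p j. induction p as [|p IH]; intros j Hj; [simpl; lra|].
  eapply Rle_trans; [apply moment_shift; lia|].
  replace (S p + j)%nat with (p + S j)%nat by lia. apply IH. lia.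
Qed.

(** A Rayleigh quotient of at least [c] propagates to all powers: [moment_mul_le] with first
    exponent 1 is the induction step. *)
Lemma moment_ge_pow x c k :
  0 <= c -> 0 < dot r x x -> c * dot r x x <= dot r x (T x) -> c ^ k * dot r x x <= moment r T x k.
Proof.
  intros Hc Hx H. induction k as [|k IH]; [unfold moment; simpl; lra|].
  assert (G := moment_mul_le x 1 k). assert (G0 := moment_nonneg x k).
  change (moment r T x 1) with (dot r x (T x)) in G.
  change (moment r T x 0) with (dot r x x) in G.
  apply Rmult_le_reg_l with (dot r x x); [easy|]. simpl.
  eapply Rle_trans; [|apply G].
  apply Rle_trans with (c * dot r x x * moment r T x k); [|now apply Rmult_le_compat_r].
  replace (dot r x x * (c * c ^ k * dot r x x)) with (c * dot r x x * (c ^ k * dot r x x)) by ring.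
  apply Rmult_le_compat_l; [nra|easy].
Qed.

Lemma trace_power_double k :
  trace r (power T (k + k)) = sumR r (fun a => dot r (power T k (e_vec a)) (power T k (e_vec a))).
Proof.
  apply sumR_ext. intros a Ha. now rewrite dot_power_power, dot_e_vec.
Qed.

(** The Hilbert-Schmidt norm of [T^k] dominates its operator norm; the even exponent makes both
    sides sums of squares. *)
Lemma moment_le_trace x k : moment r T x (k + k) <= trace r (power T (k + k)) * dot r x x.
Proof.
  rewrite trace_power_double. unfold moment. rewrite <- dot_power_power.
  rewrite Rmult_comm, <- sumR_scal. apply sumR_le. intros a Ha.
  rewrite <- (dot_e_vec r a (power T k x)) by easy.
  rewrite <- (power_symmetric k (e_vec a) x), (Rmult_comm (dot r x x)).
  assert (H := cauchy_schwarz r (power T k (e_vec a)) x). simpl in H. lra.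
Qed.

Context (U : nat -> nat -> R) (d : nat).
Hypothesis U_orth : orthonormal_cols d r U.

(** Orthonormal columns mean that the matrices [U_i U_i^T] sum to the identity. *)
Lemma sumR_quadratic_trace k :
  sumR d (fun i => moment r T (U i) k) = trace r (power T k).
Proof.
  unfold moment, dot. rewrite sumR_swap. apply sumR_ext. intros a Ha.
  transitivity (sumR d (fun i => sumR r (fun b => power T k (e_vec a) b * (U i a * U i b)))).
  - apply sumR_ext. intros i Hi.
    rewrite <- (dot_e_vec r a (power T k (U i))), <- power_symmetric by easy.
    unfold dot. rewrite <- sumR_scal. apply sumR_ext. intros; ring.
  - rewrite sumR_swap.
    transitivity (sumR r (fun b => e_vec a b * power T k (e_vec a) b)); [|now apply sumR_e_vec].
    apply sumR_ext. intros b Hb. rewrite sumR_scal, U_orth by easy. unfold e_vec. ring.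
Qed.

End Powers.

(** * The effect of a rank one update on powers and traces *)

Section RankOne.

Context (r : nat) (M M' : (nat -> R) -> nat -> R) (u : nat -> R) (eta : R).
Hypothesis M_sym : symmetric r M.
Hypothesis M'_sym : symmetric r M'.
Hypothesis M_pos : psd r M.
Hypothesis M'_pos : psd r M'.
Hypothesis M'_eq : forall z x, dot r z (M' x) = dot r z (M x) - eta * dot r u x * dot r z u.
Hypothesis eta_nonneg : 0 <= eta.

(** The identity [M^n - M'^n = eta * sum M^(n-1-i) u u^T M'^i], tested against [z] and [x]. *)
Lemma power_telescope n z x :
  dot r z (power M n x) - dot r z (power M' n x) =
  eta * sumR n (fun i => dot r z (power M (n - 1 - i) u) * dot r u (power M' i x)).
Proof.
  revert z. induction n as [|n IH]; intros z; [simpl; lra|].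
  change (power M (S n) x) with (M (power M n x)).
  change (power M' (S n) x) with (M' (power M' n x)).
  rewrite M'_eq, <- !M_sym.
  transitivity (dot r (M z) (power M n x) - dot r (M z) (power M' n x)
                + eta * dot r u (power M' n x) * dot r z u); [ring|].
  rewrite IH. simpl sumR. rewrite Rmult_plus_distr_l.
  replace (n - 0 - n)%nat with O by lia. f_equal; [|change (power M 0 u) with u; ring].
  f_equal. apply sumR_ext. intros i Hi. f_equal.
  rewrite M_sym. now replace (n - 0 - i)%nat with (S (n - 1 - i)) by lia.
Qed.

Lemma rank_one_moment_le k : moment r M' u k <= moment r M u k.
Proof.
  assert (H := power_telescope k u u).
  assert (0 <= eta * sumR k (fun i => dot r u (power M (k - 1 - i) u) * dot r u (power M' i u))).
  { apply Rmult_le_pos; [easy|]. apply sumR_nonneg. intros i _.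
    apply Rmult_le_pos; now apply moment_nonneg. }
  unfold moment. lra.
Qed.

(** Telescoping replaces [M'^i] by [M^i] with [i] error terms; each is a product of moments, bounded
    by [rank_one_moment_le] and [moment_mul_le]. For [i = 0] the factor [INR i] cancels the
    truncated exponent. *)
Lemma rank_one_mixed_ge p i :
  moment r M u (p + i) - eta * INR i * (moment r M u 0 * moment r M u (p + i - 1)) <=
  dot r (power M p u) (power M' i u).
Proof.
  assert (H := power_telescope i (power M p u) u).
  rewrite (dot_power_power r M M_sym) in H.
  enough (K : sumR i (fun j => dot r (power M p u) (power M (i - 1 - j) u) *
                               dot r u (power M' j u))
              <= INR i * (moment r M u 0 * moment r M u (p + i - 1))).
  { apply Rmult_le_compat_l with (r := eta) in K; [|easy]. unfold moment in *. lra. }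
  rewrite <- sumR_const. apply sumR_le. intros j Hj.
  rewrite (dot_power_power r M M_sym).
  apply Rle_trans with (moment r M u (p + (i - 1 - j)) * moment r M u j).
  - apply Rmult_le_compat_l; [now apply moment_nonneg|]. apply rank_one_moment_le.
  - replace (p + i - 1)%nat with (p + (i - 1 - j) + j)%nat by lia.
    now apply moment_mul_le.
Qed.

(* A second order Taylor bound along the segment from [M] to [M']. *)
Lemma rank_one_trace_le n :
  trace r (power M' (S (S n))) <= trace r (power M (S (S n)))
    - eta * INR (S (S n)) * moment r M u (S n)
    + (eta * INR (S (S n))) ^ 2 / 2 * (moment r M u 0 * moment r M u n).
Proof.
  (* The trace of [M^(n+1-i) u u^T M'^i] is the inner product of [M^(n+1-i) u] and [M'^i u]. *)
  assert (E : trace r (power M (S (S n))) - trace r (power M' (S (S n))) =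
    eta * sumR (S (S n)) (fun i => dot r (power M (S n - i) u) (power M' i u))).
  { unfold trace. rewrite <- sumR_minus.
    transitivity (sumR r (fun a => eta * sumR (S (S n)) (fun i =>
      power M (S n - i) u a * power M' i u a))).
    - apply sumR_ext. intros a Ha.
      rewrite <- !(dot_e_vec r a) by easy. rewrite power_telescope.
      f_equal. apply sumR_ext. intros i Hi. f_equal.
      + rewrite dot_e_vec by easy. now replace (S (S n) - 1 - i)%nat with (S n - i)%nat by lia.
      + now rewrite <- (power_symmetric r M' M'_sym), dot_comm, dot_e_vec.
    - rewrite sumR_scal. f_equal. apply sumR_swap. }
  assert (H : sumR (S (S n)) (fun i => moment r M u (S n)
                - eta * (moment r M u 0 * moment r M u n) * INR i)
              <= sumR (S (S n)) (fun i => dot r (power M (S n - i) u) (power M' i u))).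
  { apply sumR_le. intros i Hi. assert (K := rank_one_mixed_ge (S n - i) i).
    replace (S n - i + i)%nat with (S n) in K by lia.
    replace (S n - 1)%nat with n in K by lia. lra. }
  rewrite sumR_minus, sumR_const, sumR_scal in H.
  (* This sum supplies the factor 1/2 of the second order term. *)
  assert (G : forall N, sumR N INR <= INR N ^ 2 / 2).
  { induction N as [|N IHN]; [simpl; lra|]. simpl sumR. rewrite S_INR. nra. }
  specialize (G (S (S n))).
  assert (0 <= moment r M u 0 * moment r M u n)
    by (apply Rmult_le_pos; now apply moment_nonneg).
  apply Rmult_le_compat_l with (r := eta * (moment r M u 0 * moment r M u n)) in G;
    [|now apply Rmult_le_pos].
  apply Rmult_le_compat_l with (r := eta) in H; [|easy].
  apply Rmult_le_compat_l with (r := eta) in G; [|easy].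
  change (fun x => INR x) with INR in H. lra.
Qed.

End RankOne.

(** * A lower tail for the smallest eigenvalue of [U_Om^T U_Om] *)

Section LambdaMin.

Context (r d m : nat) (U : nat -> nat -> R) (B gamma : R).
Hypothesis U_orth : orthonormal_cols d r U.
Hypothesis U_bound : forall i, (i < d)%nat -> dot r (U i) (U i) <= B.
Hypothesis m_pos : (0 < m)%nat.
Hypothesis B_ge : 1 <= INR d * B.
Hypothesis gamma_range : 0 < gamma < 1.

Definition gram_form (l : list nat) (x : nat -> R) : R := lsum (fun i => dot r (U i) x ^ 2) l.

(* [1 - eta * sum_(i in l) U_i U_i^T], where [U_i] is row [i] of [U] *)
Fixpoint gram_gap (eta : R) (l : list nat) (x : nat -> R) : nat -> R :=
  match l with
  | [] => x
  | i :: l => fun a => gram_gap eta l x a + - eta * dot r (U i) x * U i a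
  end.

Lemma dot_gram_gap_cons eta i l z x :
  dot r z (gram_gap eta (i :: l) x) =
  dot r z (gram_gap eta l x) - eta * dot r (U i) x * dot r z (U i).
Proof. simpl. rewrite dot_plus_r, dot_scal_r. ring. Qed.

Lemma gram_gap_symmetric eta l : symmetric r (gram_gap eta l).
Proof.
  intros x y. rewrite dot_comm. revert x y. induction l as [|i l IH]; intros x y; [apply dot_comm|].
  rewrite !dot_gram_gap_cons, IH, (dot_comm r y (U i)), (dot_comm r x (U i)). ring.
Qed.

Lemma dot_gram_gap eta l x : dot r x (gram_gap eta l x) = dot r x x - eta * gram_form l x.
Proof.
  unfold gram_form. induction l as [|i l IH]; [simpl; ring|].
  rewrite dot_gram_gap_cons, IH, (dot_comm r x (U i)). simpl. ring.
Qed.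

Lemma gram_form_bounds l x : (forall j, In j l -> (j < d)%nat) ->
  0 <= gram_form l x <= INR (length l) * B * dot r x x.
Proof.
  unfold gram_form. induction l as [|i l IH]; intros Hl; [simpl; lra|].
  specialize (IH (fun j Hj => Hl j (or_intror Hj))).
  change (length (i :: l)) with (S (length l)). rewrite S_INR. cbn [lsum fold_right].
  assert (H := cauchy_schwarz r (U i) x). assert (G := U_bound i (Hl i (or_introl eq_refl))).
  assert (0 <= dot r (U i) x ^ 2) by apply pow2_ge_0.
  assert (dot r (U i) (U i) * dot r x x <= B * dot r x x)
    by (apply Rmult_le_compat_r; [apply dot_self_nonneg|easy]).
  unfold lsum in IH. lra.
Qed.

(* [n = 20 m] makes [1 - eps <= 1 - eta U_Om^T U_Om <= 1]; with this [eps], replacing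
   the exponential by the [n]-th power costs no more than the difference between the
   Chernoff exponent [gamma^2 / 2] and the [3 / 8 * gamma^2] of [gram_lower_tail]. *)
Let eps := gamma / 20.
Let n := (20 * m)%nat.
Let eta := gamma / (B * INR n).

Let INR_m_pos : 0 < INR m.
Proof. now apply lt_0_INR. Qed.

Let INR_n : INR n = 20 * INR m.
Proof. unfold n. rewrite mult_INR. f_equal. simpl. lra. Qed.

Let d_pos : 0 < INR d.
Proof.
  destruct (pos_INR d) as [H|H]; [easy|]. rewrite <- H in B_ge. lra.
Qed.

Let B_pos : 0 < B.
Proof. apply Rmult_lt_reg_l with (INR d); lra. Qed.

Let eta_pos : 0 < eta.
Proof. apply Rdiv_lt_0_compat; [lra|]. rewrite INR_n. nra. Qed.

Let eta_n : eta * INR n = gamma / B.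
Proof. unfold eta. field. rewrite INR_n. lra. Qed.

Let eta_m : eta * (INR m * B) = eps.
Proof. unfold eta, eps. rewrite INR_n. field. lra. Qed.

Lemma gram_gap_lower l x : (length l <= m)%nat -> (forall j, In j l -> (j < d)%nat) ->
  (1 - eps) * dot r x x <= dot r x (gram_gap eta l x).
Proof.
  intros Hm Hl. rewrite dot_gram_gap, <- eta_m.
  destruct (gram_form_bounds l x Hl) as [_ H]. apply le_INR in Hm.
  assert (G := dot_self_nonneg r x).
  assert (gram_form l x <= INR m * B * dot r x x).
  { eapply Rle_trans; [apply H|]. apply Rmult_le_compat_r; [easy|]. nra. }
  nra.
Qed.

Lemma gram_gap_upper l x : (forall j, In j l -> (j < d)%nat) ->
  dot r x (gram_gap eta l x) <= dot r x x.
Proof.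
  intros Hl. rewrite dot_gram_gap. destruct (gram_form_bounds l x Hl) as [H _]. nra.
Qed.

Lemma gram_gap_positive l : (length l <= m)%nat -> (forall j, In j l -> (j < d)%nat) ->
  psd r (gram_gap eta l).
Proof.
  intros Hm Hl x. assert (H := gram_gap_lower l x Hm Hl). assert (G := dot_self_nonneg r x).
  assert (0 <= (1 - eps) * dot r x x) by (apply Rmult_le_pos; unfold eps; lra). lra.
Qed.

(** The operator inequalities [(1 - eps)^2 <= M^2 <= M] for [1 - eps <= M <= 1]. The lower one is
    Cauchy-Schwarz for [x] and [M x]; the upper one is Cauchy-Schwarz for the form of [M] at the
    same vectors. *)
Lemma gram_gap_norm_bounds l x : (length l <= m)%nat -> (forall j, In j l -> (j < d)%nat) ->
  let y := gram_gap eta l x in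
  (1 - eps) ^ 2 * dot r x x <= dot r y y <= dot r x y.
Proof.
  intros Hm Hl y.
  assert (P := gram_gap_positive l Hm Hl). assert (S := gram_gap_symmetric eta l).
  assert (H0 := gram_gap_lower l x Hm Hl). fold y in H0.
  assert (C1 := cauchy_schwarz r x y).
  assert (C2 := form_cauchy_schwarz r _ x y S P). rewrite <- (S x y) in C2. fold y in C2.
  assert (H1 := gram_gap_upper l y Hl).
  assert (Gx := dot_self_nonneg r x). assert (Gy := dot_self_nonneg r y).
  assert (Gxy := P x). fold y in Gxy.
  assert (0 < 1 - eps) by (unfold eps; lra).
  split.
  - destruct Gx as [Gx|Gx]; [|rewrite <- Gx; lra].
    apply Rmult_le_reg_l with (dot r x x); [easy|].
    assert (((1 - eps) * dot r x x) ^ 2 <= dot r x y ^ 2) by (apply pow_incr; nra). lra.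
  - destruct Gy as [Gy|Gy]; [|lra].
    apply Rmult_le_reg_l with (dot r y y); [easy|].
    assert (dot r x y * dot r y (gram_gap eta l y) <= dot r x y * dot r y y)
      by (apply Rmult_le_compat_l; lra).
    lra.
Qed.

(** The relative growth of the trace potential per draw: first order term [- gamma], second order
    term with the loss [(1 - eps)^-2], both over [d * B]. *)
Let kappa := (gamma ^ 2 / (2 * (1 - eps) ^ 2) - gamma) / (INR d * B).

(** Averaging [rank_one_trace_le] over the rows turns its moments into traces of [M^(n-1)] and
    [M^(n-2)], which [gram_gap_norm_bounds] compares with the trace of [M^n]. *)
Lemma gram_gap_trace_step l : (length l < m)%nat -> (forall j, In j l -> (j < d)%nat) ->
  sumR d (fun i => trace r (power (gram_gap eta (i :: l)) n)) <=
  INR d * exp kappa * trace r (power (gram_gap eta l) n).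
Proof.
  intros Hm Hl. set (M := gram_gap eta l).
  assert (M_sym : symmetric r M) by apply gram_gap_symmetric.
  assert (M_pos : psd r M) by (apply gram_gap_positive; [lia|easy]).
  (* With [n - 2 = 2 k], the three traces are sums of [<y, y>], [<y, M y>] and [<M y, M y>] over the
     vectors [y = M^k e_a]. *)
  assert (En : exists n' k, n = S (S n') /\ n' = (k + k)%nat)
    by (exists (20 * m - 2)%nat, (10 * m - 1)%nat; unfold n; lia).
  destruct En as [n' [k [En Hk]]]. rewrite En.
  set (y := fun a => power M k (e_vec a)).
  assert (T0 : trace r (power M n') = sumR r (fun a => dot r (y a) (y a))).
  { rewrite Hk. now apply trace_power_double. }
  assert (T1 : trace r (power M (S n')) = sumR r (fun a => dot r (y a) (M (y a)))).
  { apply sumR_ext. intros a Ha. rewrite <- (dot_e_vec r a) by easy.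
    replace (S n') with (k + S k)%nat by lia. now rewrite <- dot_power_power. }
  assert (T2 : trace r (power M (S (S n'))) = sumR r (fun a => dot r (M (y a)) (M (y a)))).
  { replace (S (S n')) with (S k + S k)%nat by lia. now apply trace_power_double. }
  assert (N : forall a, (1 - eps) ^ 2 * dot r (y a) (y a) <= dot r (M (y a)) (M (y a))
                        <= dot r (y a) (M (y a))).
  { intros a. apply gram_gap_norm_bounds; [lia|easy]. }
  assert (N1 : trace r (power M (S (S n'))) <= trace r (power M (S n'))).
  { rewrite T1, T2. apply sumR_le. intros a _. apply N. }
  assert (N2 : (1 - eps) ^ 2 * trace r (power M n') <= trace r (power M (S (S n')))).
  { rewrite T0, T2, <- sumR_scal. apply sumR_le. intros a _. apply N. }
  assert (N3 : 0 <= trace r (power M (S (S n')))).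
  { rewrite T2. apply sumR_nonneg. intros; apply dot_self_nonneg. }
  clear T0 T1 T2 N y.
  apply Rle_trans with (sumR d (fun i => trace r (power M (S (S n')))
    - eta * INR (S (S n')) * moment r M (U i) (S n')
    + (eta * INR (S (S n'))) ^ 2 / 2 * B * moment r M (U i) n')).
  - apply sumR_le. intros i Hi.
    eapply Rle_trans; [apply (rank_one_trace_le r M (gram_gap eta (i :: l)) (U i) eta)|].
    + easy.
    + apply gram_gap_symmetric.
    + easy.
    + apply gram_gap_positive; [simpl; lia|]. intros j [<-|Hj]; auto.
    + intros z x. apply dot_gram_gap_cons.
    + lra.
    + apply Rplus_le_compat_l. rewrite Rmult_assoc. apply Rmult_le_compat_l.
      * assert (0 <= (eta * INR (S (S n'))) ^ 2) by apply pow2_ge_0. lra.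
      * apply Rmult_le_compat_r; [now apply moment_nonneg|]. now apply U_bound.
  - rewrite sumR_plus, sumR_minus, sumR_const, !sumR_scal.
    rewrite !(sumR_quadratic_trace r M M_sym U d U_orth), <- En, eta_n, En.
    set (t0 := trace r (power M n')) in *. set (t1 := trace r (power M (S n'))) in *.
    set (t2 := trace r (power M (S (S n')))) in *.
    assert (He : 0 < (1 - eps) ^ 2) by (apply pow_lt; unfold eps; lra).
    assert (t0 <= / (1 - eps) ^ 2 * t2).
    { apply Rmult_le_reg_l with ((1 - eps) ^ 2); [easy|]. rewrite <- Rmult_assoc, Rinv_r; lra. }
    assert (0 < gamma / B) by (apply Rdiv_lt_0_compat; lra).
    apply Rle_trans with (INR d * t2 - gamma / B * t2
                          + (gamma / B) ^ 2 / 2 * B * (/ (1 - eps) ^ 2 * t2)).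
    + assert (gamma / B * t2 <= gamma / B * t1) by (apply Rmult_le_compat_l; lra).
      assert ((gamma / B) ^ 2 / 2 * B * t0 <= (gamma / B) ^ 2 / 2 * B * (/ (1 - eps) ^ 2 * t2)).
      { apply Rmult_le_compat_l; [|easy].
        assert (0 <= (gamma / B) ^ 2) by apply pow2_ge_0. nra. }
      lra.
    + replace (INR d * t2 - gamma / B * t2 + (gamma / B) ^ 2 / 2 * B * (/ (1 - eps) ^ 2 * t2))
        with (INR d * (1 + kappa) * t2)
        by (unfold kappa; field; repeat split; unfold eps; lra).
      apply Rmult_le_compat_r; [easy|]. apply Rmult_le_compat_l; [lra|]. apply exp_ge_1.
Qed.

(** Since [1 / (1 - x) = 1 + x / (1 - x) <= exp (x / (1 - x))]. *)
Lemma exp_le_pow_1_sub x k : 0 <= x < 1 -> exp (- (INR k * (x / (1 - x)))) <= (1 - x) ^ k.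
Proof.
  intros Hx. induction k as [|k IH].
  - simpl. rewrite Rmult_0_l, Ropp_0, exp_0. lra.
  - rewrite S_INR. replace (- ((INR k + 1) * (x / (1 - x))))
      with (- (x / (1 - x)) + - (INR k * (x / (1 - x)))) by ring.
    rewrite exp_plus. simpl.
    apply Rmult_le_compat; [left; apply exp_pos..| |easy].
    rewrite exp_Ropp, <- (Rinv_inv (1 - x)). apply Rinv_le_contravar.
    + apply Rinv_0_lt_compat; lra.
    + eapply Rle_trans; [|apply exp_ge_1]. right. field. lra.
Qed.

(** A vector [x] violating the bound has Rayleigh quotient at least [1 - eta * lam] for [gram_gap],
    which forces the trace of the [n]-th power up to [(1 - eta * lam)^n]. The potential starts at
    the trace of the identity, [r]. *)
Lemma gram_lower_tail :
  INR (count (fun l => exists x, gram_form l x < (1 - gamma) * INR m / INR d * dot r x x)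
    (words d m)) <= INR r * exp (- (3 / 8 * gamma ^ 2 * INR m / (INR d * B))) * INR d ^ m.
Proof.
  set (lam := (1 - gamma) * INR m / INR d).
  assert (Hlam : 0 < lam) by (apply Rdiv_lt_0_compat; nra).
  assert (HdB : 0 < INR d * B) by lra.
  assert (Hel : eta * lam = eps * (1 - gamma) / (INR d * B)).
  { rewrite <- eta_m. unfold lam. field. lra. }
  assert (Hel1 : eta * lam <= eps).
  { rewrite Hel. apply Rmult_le_reg_r with (INR d * B); [easy|].
    unfold Rdiv. rewrite Rmult_assoc, Rinv_l, Rmult_1_r by lra.
    assert (0 < eps) by (unfold eps; lra). nra. }
  assert (Hel0 : 0 <= eta * lam) by (apply Rmult_le_pos; lra).
  assert (He : eps < 1) by (unfold eps; lra).
  assert (C := count_supermartingale d m (fun l => exists x, gram_form l x < lam * dot r x x)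
    (fun l => trace r (power (gram_gap eta l) n)) kappa ((1 - eta * lam) ^ n)).
  assert (En : n = (10 * m + 10 * m)%nat) by (unfold n; lia).
  assert (Ht : 0 < (1 - eta * lam) ^ n) by (apply pow_lt; lra).
  apply Rmult_le_reg_r with ((1 - eta * lam) ^ n); [easy|].
  eapply Rle_trans; [apply C|].
  - intros l Hm Hl. rewrite En, trace_power_double by apply gram_gap_symmetric.
    apply sumR_nonneg. intros; apply dot_self_nonneg.
  - apply gram_gap_trace_step.
  - intros l Hm Hl [x Hx].
    assert (Gx := dot_self_nonneg r x).
    destruct (gram_form_bounds l x Hl) as [Gf _].
    (* The strict inequality together with [gram_form >= 0] excludes [x = 0]. *)
    assert (0 < dot r x x) by nra.
    apply Rmult_le_reg_r with (dot r x x); [easy|].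
    assert (S := gram_gap_symmetric eta l).
    assert (P := gram_gap_positive l ltac:(lia) Hl).
    apply Rle_trans with (moment r (gram_gap eta l) x n).
    + apply moment_ge_pow; [easy..|lra|easy|]. rewrite dot_gram_gap. nra.
    + rewrite En. now apply moment_le_trace.
  - replace (trace r (power (gram_gap eta []) n)) with (INR r).
    2: { unfold trace. transitivity (sumR r (fun _ => 1)); [rewrite sumR_const; ring|].
         apply sumR_ext. intros a _. unfold power. clear - a.
         induction n as [|k IH]; simpl; [|easy]. unfold e_vec. now rewrite Nat.eqb_refl. }
    apply Rle_trans with
      (INR r * exp (- (3 / 8 * gamma ^ 2 * INR m / (INR d * B))) * INR d ^ m *
       exp (- (INR n * (eta * lam / (1 - eta * lam))))).
    + replace (INR r * exp (- (3 / 8 * gamma ^ 2 * INR m / (INR d * B))) * INR d ^ m *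
        exp (- (INR n * (eta * lam / (1 - eta * lam)))))
        with (INR d ^ m * exp (- (3 / 8 * gamma ^ 2 * INR m / (INR d * B))
          + - (INR n * (eta * lam / (1 - eta * lam)))) * INR r) by (rewrite exp_plus; ring).
      apply Rmult_le_compat_r; [apply pos_INR|].
      apply Rmult_le_compat_l; [apply pow_le, pos_INR|]. apply exp_le.
      set (w := / (1 - eps) ^ 2).
      set (K := INR m / (INR d * B)).
      assert (HK : 0 < K) by now apply Rdiv_lt_0_compat.
      assert (Ek : INR m * kappa = K * (gamma ^ 2 * w / 2 - gamma)).
      { unfold K, kappa, w. field. lra. }
      assert (Hnl : INR n * (eta * lam / (1 - eta * lam)) <= K * (gamma * (1 - gamma)) * w).
      { replace (INR n * (eta * lam / (1 - eta * lam)))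
          with (eta * INR n * lam * / (1 - eta * lam)) by (unfold Rdiv; ring).
        replace (eta * INR n * lam) with (K * (gamma * (1 - gamma)))
          by (rewrite eta_n; unfold K, lam; field; lra).
        apply Rmult_le_compat_l; [apply Rmult_le_pos; nra|].
        apply Rinv_le_contravar; [apply pow_lt; lra|]. unfold eps in *. nra. }
      rewrite Ek.
      replace (3 / 8 * gamma ^ 2 * INR m / (INR d * B)) with (K * (3 / 8 * gamma ^ 2))
        by (unfold K; field; lra).
      (* The two exponents add up to at most [K gamma (w (1 - gamma / 2) - 1)]; this bound makes it
         at most [- 3/8 K gamma^2]. *)
      assert (Hw : w * (1 - gamma / 2) <= 1 - 3 * gamma / 8).
      { apply Rmult_le_reg_l with ((1 - eps) ^ 2); [apply pow_lt; lra|].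
        unfold w. rewrite <- Rmult_assoc, Rinv_r, Rmult_1_l by (apply pow_nonzero; lra).
        unfold eps. nra. }
      assert (K * gamma * (w * (1 - gamma / 2)) <= K * gamma * (1 - 3 * gamma / 8))
        by (apply Rmult_le_compat_l; [nra|easy]).
      lra.
    + apply Rmult_le_compat_l.
      * repeat apply Rmult_le_pos; [apply pos_INR|left; apply exp_pos|apply pow_le, pos_INR].
      * apply exp_le_pow_1_sub. lra.
Qed.

End LambdaMin.

(** * Leverage scores and the projection residual *)

Lemma parseval d r U z : orthonormal_cols d r U ->
  sumR d (fun j => dot r (U j) z * dot r (U j) z) = dot r z z.
Proof.
  intros HU.
  transitivity (sumR d (fun j => sumR r (fun a => sumR r (fun b => z a * z b * (U j a * U j b))))).
  - apply sumR_ext. intros j _. unfold dot at 1. rewrite Rmult_comm, <- sumR_scal.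
    apply sumR_ext. intros a _. unfold dot. rewrite Rmult_comm, <- sumR_scal.
    apply sumR_ext. intros; ring.
  - rewrite sumR_swap. apply sumR_ext. intros a Ha.
    rewrite sumR_swap.
    transitivity (sumR r (fun b => e_vec a b * (z a * z b))); [|now apply sumR_e_vec].
    apply sumR_ext. intros b Hb. rewrite sumR_scal, HU by easy. unfold e_vec. ring.
Qed.

(** Identifies the maximum inside [mu_sub] with the largest leverage score. *)
Lemma norm2_proj_e_vec d r U i : orthonormal_cols d r U -> (i < d)%nat ->
  norm2 d (proj_on d r U (e_vec i)) = dot r (U i) (U i).
Proof.
  intros HU Hi. rewrite <- (parseval d r U) by easy. apply sumR_ext. intros j _.
  enough (E : proj_on d r U (e_vec i) j = dot r (U j) (U i)) by now rewrite E.
  apply sumR_ext. intros a _. f_equal.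
  rewrite <- (sumR_e_vec d i (fun k => U k a)) by easy. apply sumR_ext. intros; ring.
Qed.

Lemma sumR_leverage d r U : orthonormal_cols d r U ->
  sumR d (fun i => dot r (U i) (U i)) = INR r.
Proof.
  intros HU. unfold dot. rewrite sumR_swap.
  rewrite (sumR_ext r _ (fun _ => 1)); [rewrite sumR_const; ring|].
  intros a Ha. rewrite HU, Nat.eqb_refl by easy. reflexivity.
Qed.

(** The square of the score is one term of the Parseval sum for [U i], whose value is the score
    itself. *)
Lemma leverage_le_1 d r U i : orthonormal_cols d r U -> (i < d)%nat -> dot r (U i) (U i) <= 1.
Proof.
  intros HU Hi.
  assert (H := sumR_term_le d (fun j => dot r (U j) (U i) * dot r (U j) (U i)) i Hi).
  rewrite (parseval d r U) in H by easy.
  specialize (H (fun j _ => Rle_0_sqr _)). simpl in H.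
  assert (G := dot_self_nonneg r (U i)). nra.
Qed.

(** Write [p - x = A w]. The residual is [v - A w], orthogonal to the columns, so its squared norm
    is [|v|^2 - Q] with [Q = |A w|^2 = <w, W>]. Then [lam Q^2 <= lam |w|^2 |W|^2 <= Q |W|^2] bounds
    [Q]. *)
Lemma residual_bounds m r A x v p lam :
  in_colspan m r A x -> is_orth_proj m r A (fun j => x j + v j) p -> 0 < lam ->
  (forall w, lam * dot r w w <= norm2 m (fun j => dot r (A j) w)) ->
  let W := fun a => sumR m (fun j => A j a * v j) in
  norm2 m v - dot r W W / lam <= norm2 m (fun j => x j + v j - p j) <= norm2 m v.
Proof.
  intros [c0 Hx] [[c Hp] Ho] Hlam HA W.
  set (w := fun a => c a + - 1 * c0 a).
  set (e := fun j => v j - dot r (A j) w).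
  assert (He : forall j, (j < m)%nat -> x j + v j - p j = e j).
  { intros j Hj. unfold e, w. rewrite dot_plus_r, dot_scal_r, Hx, Hp by easy. unfold dot. ring. }
  assert (Horth : forall a, (a < r)%nat -> sumR m (fun j => A j a * e j) = 0).
  { intros a Ha. rewrite <- (Ho a Ha). apply sumR_ext. intros j Hj. now rewrite He. }
  assert (Hdot : forall s, sumR m (fun j => dot r (A j) w * s j)
                 = sumR r (fun a => w a * sumR m (fun j => A j a * s j))).
  { intros s. transitivity (sumR m (fun j => sumR r (fun a => w a * (A j a * s j)))).
    - apply sumR_ext. intros j _. rewrite Rmult_comm. unfold dot. rewrite <- sumR_scal.
      apply sumR_ext. intros; ring.
    - rewrite sumR_swap. apply sumR_ext. intros a _. now rewrite sumR_scal. }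
  assert (Horthw : sumR m (fun j => dot r (A j) w * e j) = 0).
  { rewrite Hdot. apply sumR_0. intros a Ha. rewrite Horth; [ring|easy]. }
  set (Q := norm2 m (fun j => dot r (A j) w)).
  assert (HQ : dot r w W = Q).
  { apply Rminus_diag_uniq. rewrite <- Horthw. unfold Q, norm2.
    change (dot r w W) with (sumR r (fun a => w a * sumR m (fun j => A j a * v j))).
    rewrite <- Hdot, <- sumR_minus. apply sumR_ext. intros j _. unfold e. ring. }
  assert (HE : norm2 m (fun j => x j + v j - p j) = norm2 m v - Q).
  { transitivity (sumR m (fun j => v j * v j - dot r (A j) w * v j - dot r (A j) w * e j)).
    - apply sumR_ext. intros j Hj. rewrite He by easy. unfold e. ring.
    - rewrite !sumR_minus, Horthw, Hdot. change (norm2 m v - dot r w W - 0 = norm2 m v - Q).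
      rewrite HQ. ring. }
  rewrite HE.
  assert (HQ0 : 0 <= Q) by (apply sumR_nonneg; intros; apply Rle_0_sqr).
  assert (C := cauchy_schwarz r w W). rewrite HQ in C.
  assert (GW := dot_self_nonneg r W). assert (HAw := HA w). fold Q in HAw.
  enough (Q <= dot r W W / lam) by lra.
  apply Rmult_le_reg_r with lam; [easy|].
  unfold Rdiv. rewrite Rmult_assoc, Rinv_l, Rmult_1_r by lra.
  destruct HQ0 as [HQ0|HQ0]; [|rewrite <- HQ0; lra].
  apply Rmult_le_reg_r with Q; [easy|].
  assert (lam * dot r w w * dot r W W <= Q * dot r W W) by now apply Rmult_le_compat_r.
  assert (lam * Q ^ 2 <= lam * (dot r w w * dot r W W)) by (apply Rmult_le_compat_l; lra).
  lra.
Qed.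

(** * The four events and their union bound *)

Lemma lsum_scal c f l : lsum (fun i => c * f i) l = c * lsum f l.
Proof. induction l as [|i l IH]; simpl; [|rewrite IH]; ring. Qed.

Theorem theorem4 (d r m : nat) (U : nat -> nat -> R) (x v : nat -> R) (delta : R) :
  (0 < r)%nat ->
  orthonormal_cols d r U ->
  in_colspan d r U x ->
  orth_colspan d r U v ->
  (exists i, (i < d)%nat /\ v i <> 0) ->
  0 < delta < 1 ->
  8 / 3 * INR r * mu_sub d r U * ln (2 * INR d / delta) <= INR m ->
  4 * mu_vec d v * ln (1 / delta) <= INR m ->
  gamma_c d r m (mu_sub d r U) delta < 1 ->
  exists G : list (list nat),
    NoDup G /\
    (forall Om, In Om G ->
       length Om = m /\ (forall j, In j Om -> (j < d)%nat) /\
       good_event d r m U (fun i => x i + v i) v delta Om) /\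
    (1 - 4 * delta) * INR d ^ m <= INR (length G).
Proof.
  intros Hr HU Hx Hv [i0 [Hi0 Hvi0]] Hdelta Hm1 Hm2 Hgamma.
  (* For [delta > 1/4] the claimed count is nonpositive and the empty list serves; otherwise
     [L >= ln 4]. *)
  destruct (Rle_dec delta (1 / 4)) as [Hd4|Hd4].
  2: { exists []. split; [constructor|]. split; [easy|]. simpl.
       assert (0 <= INR d ^ m) by (apply pow_le, pos_INR). nra. }
  set (L := ln (1 / delta)) in *.
  assert (HL : 1.38 <= L).
  { eapply Rle_trans; [apply ln_4_ge|]. apply ln_le; [lra|].
    apply Rmult_le_reg_r with delta; [lra|]. field_simplify; lra. }
  assert (HLd : exp (- L) = delta).
  { unfold L. rewrite exp_Ropp, exp_ln; [field; lra|]. apply Rdiv_lt_0_compat; lra. }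
  assert (Hd : 1 <= INR d) by (apply (le_INR 1); lia).
  assert (Hr1 : 1 <= INR r) by (apply (le_INR 1); lia).
  set (N := norm2 d v) in *.
  assert (HN : 0 < N).
  { apply Rlt_le_trans with (v i0 * v i0); [nra|].
    apply (sumR_term_le d (fun i => v i * v i)); [easy|]. intros; nra. }
  set (B := maxR d (fun i => norm2 d (proj_on d r U (e_vec i)))) in *.
  assert (HB : forall i, (i < d)%nat -> dot r (U i) (U i) <= B).
  { intros i Hi. rewrite <- (norm2_proj_e_vec d) by easy.
    now apply (maxR_ge d (fun i => norm2 d (proj_on d r U (e_vec i)))). }
  (* The largest leverage score is at least the average [r / d]. *)
  assert (HdB : INR r <= INR d * B).
  { rewrite <- (sumR_leverage d r U), <- sumR_const by easy. now apply sumR_le. }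
  (* Absorbs the factor [r] of [gram_lower_tail] into [delta / (2 d)]. *)
  assert (Hrd : INR r <= INR d).
  { rewrite <- (sumR_leverage d r U), <- (Rmult_1_r (INR d)), <- sumR_const by easy.
    apply sumR_le. intros i Hi. now apply (leverage_le_1 d). }
  assert (HBpos : 0 < B) by (apply Rmult_lt_reg_l with (INR d); lra).
  assert (Hmu : INR r * mu_sub d r U = INR d * B).
  { unfold mu_sub. fold B. field. lra. }
  set (muU := mu_sub d r U) in *.
  set (L2 := ln (2 * INR d / delta)) in *.
  assert (HL2 : 0 < L2).
  { rewrite <- ln_1. apply ln_increasing; [lra|].
    apply Rmult_lt_reg_r with delta; [lra|]. field_simplify; lra. }
  assert (HL2d : exp (- L2) = delta / (2 * INR d)).
  { unfold L2. rewrite exp_Ropp, exp_ln; [field; lra|]. apply Rdiv_lt_0_compat; lra. }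
  assert (Hm : 0 < INR m).
  { eapply Rlt_le_trans; [|apply Hm1]. rewrite (Rmult_assoc (8 / 3)), Hmu.
    repeat apply Rmult_lt_0_compat; lra. }
  assert (Hm0 : (0 < m)%nat) by now apply INR_lt.
  set (g := gamma_c d r m muU delta) in *.
  assert (Hg2 : 0 < 8 * (INR d * B) / (3 * INR m) * L2).
  { apply Rmult_lt_0_compat; [|easy]. apply Rdiv_lt_0_compat; lra. }
  assert (Eg : g = sqrt (8 * (INR d * B) / (3 * INR m) * L2)).
  { unfold g, gamma_c. now rewrite (Rmult_assoc 8), Hmu. }
  assert (Hg : 0 < g) by (rewrite Eg; now apply sqrt_lt_R0).
  (* [gamma_c] is scaled so that the exponent of [gram_lower_tail] is exactly [L2]. *)
  assert (Eg2 : 3 / 8 * g ^ 2 * INR m / (INR d * B) = L2).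
  { rewrite Eg, pow2_sqrt by lra. field. lra. }
  set (mu := mu_vec d v) in *.
  set (vinf := norminf d v) in *.
  assert (Hvinf : forall i, (i < d)%nat -> v i * v i <= vinf ^ 2).
  { intros i Hi. replace (v i * v i) with (v i ^ 2) by ring. rewrite <- pow2_abs.
    apply pow_incr. split; [apply Rabs_pos|]. now apply (maxR_ge d (fun i => Rabs (v i))). }
  assert (Emu : mu = INR d * vinf ^ 2 / N) by reflexivity.
  assert (Hmupos : 0 < mu).
  { rewrite Emu. apply Rdiv_lt_0_compat; [|easy]. specialize (Hvinf i0 Hi0).
    apply Rmult_lt_0_compat; [lra|]. nra. }
  (* Scaled to mean 1 under a uniform draw; its upper bound is then [mu]. *)
  set (Y := fun i => INR d / N * (v i * v i)).
  assert (HdN : 0 < INR d / N) by (apply Rdiv_lt_0_compat; lra).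
  assert (HY : forall i, (i < d)%nat -> 0 <= Y i <= mu).
  { intros i Hi. split; unfold Y.
    - apply Rmult_le_pos; nra.
    - replace mu with (INR d / N * vinf ^ 2) by (rewrite Emu; field; lra).
      apply Rmult_le_compat_l; [lra|auto]. }
  assert (HYmean : sumR d Y = INR d).
  { unfold Y. rewrite sumR_scal. fold (norm2 d v). fold N. field. lra. }
  (* The scale at which [v_i U_i / sqrt V] has second moment at most [1 / m], so that
     [|U_Om^T v_Om|^2] is compared with [V * beta_c delta]. *)
  set (V := INR m * B * N / INR d).
  assert (HV : 0 < V) by (apply Rdiv_lt_0_compat; [repeat apply Rmult_lt_0_compat|]; lra).
  set (X := fun i a => / sqrt V * v i * U i a).
  assert (HsV := sqrt_lt_R0 V HV). assert (HsV2 := sqrt_sqrt V ltac:(lra)).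
  assert (HX : forall i, dot r (X i) (X i) = v i * v i / V * dot r (U i) (U i)).
  { intros i. rewrite <- HsV2. unfold X. rewrite dot_scal_l, dot_scal_r. field. lra. }
  assert (HXle : forall i, (i < d)%nat -> dot r (X i) (X i) <= v i * v i / V * B).
  { intros i Hi. rewrite HX. apply Rmult_le_compat_l; [|auto].
    apply Rmult_le_pos; [nra|]. left; now apply Rinv_0_lt_compat. }
  set (t := sqrt (2 * INR m * mu * L) + 2 * mu * L / 3).
  assert (Ht : INR m * alpha_c m mu delta = t).
  { unfold alpha_c, t. fold L. rewrite Rmult_plus_distr_l. f_equal; [|field; lra].
    rewrite <- (sqrt_square (INR m)) at 1 by lra. rewrite <- sqrt_mult.
    - f_equal. field. lra.
    - nra.
    - apply Rmult_le_pos; [|lra]. apply Rdiv_le_0_compat; lra. }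
  set (bad1 := fun l => INR m + t < lsum Y l).
  set (bad2 := fun l => lsum Y l < INR m - t).
  set (bad3 := fun l => (1 + 2 * L) ^ 2 < dot r (vsum X l) (vsum X l)).
  set (bad4 := fun l => exists w, gram_form r U l w < (1 - g) * INR m / INR d * dot r w w).
  assert (K1 : INR (count bad1 (words d m)) <= delta * INR d ^ m).
  { rewrite <- HLd. apply bernstein_upper; auto; lra. }
  assert (K2 : INR (count bad2 (words d m)) <= delta * INR d ^ m).
  { rewrite <- HLd. apply bernstein_lower; auto; lra. }
  assert (K3 : INR (count bad3 (words d m)) <= delta * INR d ^ m).
  { rewrite <- HLd. apply vector_bernstein; auto.
    (* Centring is the orthogonality of [v] to the columns of [U]. *)
    - intros a Ha. rewrite <- (Rmult_0_r (/ sqrt V)), <- (Hv a Ha), <- sumR_scal.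
      apply sumR_ext. intros. unfold X. ring.
    (* Each squared length is at most [mu / m], and [4 mu L <= m] turns this into [1 / (4 L)]. *)
    - intros i Hi. eapply Rle_trans; [now apply HXle|].
      apply Rle_trans with (mu / INR m).
      + replace (mu / INR m) with (vinf ^ 2 / V * B) by (rewrite Emu; unfold V; field; lra).
        apply Rmult_le_compat_r; [lra|]. apply Rmult_le_compat_r; [|auto].
        left; now apply Rinv_0_lt_compat.
      + apply Rmult_le_reg_r with (4 * L * INR m); [nra|]. field_simplify; lra.
    - apply Rle_trans with (sumR d (fun i => B / V * (v i * v i)) * INR m).
      + apply Rmult_le_compat_r; [lra|]. apply sumR_le. intros i Hi.
        eapply Rle_trans; [now apply HXle|]. right. field. lra.
      + right. rewrite sumR_scal. fold (norm2 d v). fold N. unfold V. field. lra. }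
  assert (K4 : INR (count bad4 (words d m)) <= delta * INR d ^ m).
  { eapply Rle_trans; [apply (gram_lower_tail r d m U B g); auto; lra|].
    apply Rmult_le_compat_r; [apply pow_le, pos_INR|].
    rewrite Eg2, HL2d. apply Rmult_le_reg_r with (2 * INR d); [lra|]. field_simplify; nra. }
  set (bad := fun l => (bad1 l \/ bad2 l) \/ (bad3 l \/ bad4 l)).
  exists (filter (fun l => decide (~ bad l)) (words d m)).
  split; [apply NoDup_filter, NoDup_words|]. split.
  - intros Om HOm. apply filter_In in HOm as [HOm Hgood].
    apply -> decide_iff in Hgood. apply in_words in HOm as [Hlen Hin].
    split; [easy|]. split; [easy|].
    unfold good_event. fold muU mu g N. intros p Hp.
    assert (R1 := residual_bounds m r (restr_mat Om U) (restr Om x) (restr Om v) p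
      ((1 - g) * INR m / INR d)).
    assert (Hlam : 0 < (1 - g) * INR m / INR d)
      by (apply Rdiv_lt_0_compat; [apply Rmult_lt_0_compat|]; lra).
    destruct R1 as [R1 R2].
    + destruct Hx as [c Hc]. exists c. intros j Hj. apply Hc, Hin, nth_In. lia.
    + exact Hp.
    + easy.
    + intros w.
      assert (E : norm2 m (fun j => dot r (restr_mat Om U j) w) = gram_form r U Om w).
      { unfold gram_form. rewrite <- sumR_nth, Hlen. apply sumR_ext. intros j _.
        change (dot r (U (nth j Om O)) w * dot r (U (nth j Om O)) w = dot r (U (nth j Om O)) w ^ 2).
        ring. }
      rewrite E. apply Rnot_lt_le. intros Hlt. apply Hgood. right; right. now exists w.
    + change (fun j => restr Om x j + restr Om v j - p j)
        with (fun j => restr Om (fun i => x i + v i) j - p j) in R1, R2.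
      set (W := fun a => sumR m (fun j => restr_mat Om U j a * restr Om v j)) in R1.
      assert (EW : dot r W W = V * dot r (vsum X Om) (vsum X Om)).
      { rewrite <- HsV2. transitivity (dot r (fun a => sqrt V * vsum X Om a) (fun a => sqrt V * vsum X Om a)).
        - assert (EWa : forall a, W a = sqrt V * vsum X Om a).
          { intros a. unfold vsum. rewrite <- lsum_scal, <- sumR_nth, Hlen. apply sumR_ext.
            intros j _. unfold X, restr_mat, restr. field. lra. }
          apply sumR_ext. intros a _. now rewrite EWa.
        - rewrite dot_scal_l, dot_scal_r. ring. }
      assert (Ev : norm2 m (restr Om v) = N / INR d * lsum Y Om).
      { unfold Y. rewrite lsum_scal, <- (sumR_nth (fun i => v i * v i)), Hlen.
        unfold norm2, restr. field. lra. }
      assert (HNd : 0 < N / INR d) by (apply Rdiv_lt_0_compat; lra).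
      assert (B1 : lsum Y Om <= INR m + t).
      { apply Rnot_lt_le. intros Hlt. apply Hgood. now left; left. }
      assert (B2 : INR m - t <= lsum Y Om).
      { apply Rnot_lt_le. intros Hlt. apply Hgood. now left; right. }
      assert (B3 : dot r (vsum X Om) (vsum X Om) <= (1 + 2 * L) ^ 2).
      { apply Rnot_lt_le. intros Hlt. apply Hgood. now right; left. }
      rewrite <- Ht in B1, B2.
      set (al := alpha_c m mu delta) in *.
      rewrite Ev in R1, R2. split.
      * eapply Rle_trans; [|apply R1].
        apply Rle_trans with (N / INR d * (INR m - INR m * al)
                              - V * (1 + 2 * L) ^ 2 / ((1 - g) * INR m / INR d)).
        (* [V] divided by the eigenvalue bound is [B N / (1 - g)], and [d B = r muU]. *)
        -- right. rewrite Hmu. unfold beta_c. fold L. unfold V. field. lra.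
        -- apply Rplus_le_compat; [apply Rmult_le_compat_l; lra|].
           apply Ropp_le_contravar, Rmult_le_compat_r; [left; now apply Rinv_0_lt_compat|].
           rewrite EW. apply Rmult_le_compat_l; lra.
      * eapply Rle_trans; [apply R2|].
        apply Rle_trans with (N / INR d * (INR m + INR m * al)); [apply Rmult_le_compat_l; lra|].
        right. field. lra.
  - change (length _) with (count (fun l => ~ bad l) (words d m)).
    assert (C := count_not bad (words d m)).
    assert (C1 := count_or (fun l => bad1 l \/ bad2 l) (fun l => bad3 l \/ bad4 l) (words d m)).
    assert (C2 := count_or bad1 bad2 (words d m)).
    assert (C3 := count_or bad3 bad4 (words d m)).
    change (count _ _ <= _)%nat with (count bad (words d m) <=
      count (fun l => bad1 l \/ bad2 l) (words d m) + count (fun l => bad3 l \/ bad4 l) (words d m))%nat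
      in C1.
    apply le_INR in C1, C2, C3. rewrite plus_INR in C1, C2, C3.
    apply (f_equal INR) in C. rewrite plus_INR, length_words in C. lra.
Qed.
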